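(* Let $(M^{2d+1},\Omega,\alpha)$ be an shs manifold with a compatible almost contact metric structure $(\Theta,E,\alpha,g)$. If the Ricci tensor $\mathrm{Ric}^g$ of $g$ is positive definite, then the SMAT shs connections (with respect to $g$) are not statistical connections; i.e. no SMAT shs connection $(\nabla,\nabla^* )$ has both $\nabla$ and $\nabla^*$ torsion-free.
   Context: A stable Hamiltonian structure (shs) on a smooth manifold $M^{2d+1}$ is a pair $(\Omega,\alpha)$ with $\Omega$ a closed 2-form and $\alpha$ a 1-form such that $\alpha\wedge\Omega^{d}$ is nowhere zero and $\ker\Omega\subset\ker d\alpha$. Its Reeb vector field $E$ is defined by $i_E\Omega=0$, $i_E\alpha=1$. A compatible almost contact metric structure $(\Theta,E,\alpha,g)$ consists of an endomorphism field $\Theta$ of $TM$ and a Riemannian metric $g$ with $\Theta^2=-I+\alpha\otimes E$, $\Theta E=0$, $\alpha\circ\Theta=0$, $\alpha=g(\cdot,E)$, $g=\Omega(\cdot,\Theta\cdot)+\alpha\otimes\alpha$. An SMAT shs connection is a pair $(\nabla,\nabla^* )$ of linear connections dual with respect to $g$, i.e. $X\,g(Y,Z)=g(\nabla_XY,Z)+g(Y,\nabla^*_XZ)$, with $\nabla$ torsion-free, $\nabla E=0$ and $\nabla\Omega=0$. It is statistical if both $\nabla$ and $\nabla^*$ are torsion-free. *)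

(* Defs.v *)
From HB Require Import structures.
From mathcomp Require Import all_boot all_order all_algebra all_fingroup.
From mathcomp Require Import all_classical all_reals all_analysis.

Set Implicit Arguments.
Unset Strict Implicit.
Unset Printing Implicit Defensive.

Import Order.TTheory GRing.Theory Num.Theory.
Import numFieldNormedType.Exports.

Local Open Scope classical_set_scope.
Local Open Scope ring_scope.

Section Smooth.
Context {R : realType} {V W : normedModType R}.

(* In finite dimension, x |-> 'd f x is C^k for the operator norm iff
   x |-> 'd f x v is C^k for every v. *)
Fixpoint Ck (k : nat) (U : set V) (f : V -> W) : Prop :=
  if k is k'.+1 then
    (forall x, U x -> differentiable f x) /\
    (forall v, Ck k' U (fun x => 'd f x v))
  else forall x, U x -> {for x, continuous f}.

Definition smooth_near (f : V -> W) (x : V) : Prop :=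
  exists2 U : set V, open_nbhs x U & forall k, Ck k U f.

End Smooth.

(* The maps are total; their values outside dom and img are irrelevant. *)
Record chart (R : realType) (n : nat) (M : topologicalType) := Chart {
  dom : set M;
  img : set 'rV[R]_n.+1;
  fwd : M -> 'rV[R]_n.+1;
  bwd : 'rV[R]_n.+1 -> M;
  dom_open : open dom;
  img_open : open img;
  fwd_img : forall p, dom p -> img (fwd p);
  bwd_dom : forall x, img x -> dom (bwd x);
  fwdK : forall p, dom p -> bwd (fwd p) = p;
  bwdK : forall x, img x -> fwd (bwd x) = x;
  fwd_continuous : forall p, dom p -> {for p, continuous fwd};
  bwd_continuous : forall x, img x -> {for x, continuous bwd}
}.

(* Smooth manifolds of dimension n.+1 (mathcomp-analysis norms 'rV[R]_k only
   for a successor k); nonempty, not necessarily connected.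
   The smooth structure is given by an atlas together with the choice of one of
   its charts around each point: the chosen charts already form an atlas of the
   same smooth structure. *)
Record manifold (R : realType) (n : nat) := Manifold {
  carrier :> topologicalType;
  carrier_nonempty : [set: carrier] !=set0;
  carrier_hausdorff : hausdorff_space carrier;
  carrier_second_countable : @second_countable carrier;
  chart_at : carrier -> chart R n carrier;
  chart_at_dom : forall p, dom (chart_at p) p;
  chart_compat : forall p q r, dom (chart_at p) r -> dom (chart_at q) r ->
    smooth_near (fwd (chart_at q) \o bwd (chart_at p)) (fwd (chart_at p) r)
}.

Section Manifold.
Context {R : realType} {n : nat} {M : manifold R n}.

(* A tangent vector at p is represented by its coordinates in chart_at p: the
   tangent space T_pM is V for every p, but identifying T_pM with T_qM in this
   way has no geometric meaning. *)
Local Notation V := 'rV[R]_n.+1.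

Implicit Types (p q : M) (X Y Z : M -> V) (f : M -> R).

(* the coordinates in chart_at b of the tangent vector at q whose coordinates
   in chart_at a are v *)
Definition coord_change (a b q : M) (v : V) : V :=
  'd (fwd (chart_at b) \o bwd (chart_at a)) (fwd (chart_at a) q) v.

(* the vector field X read in chart_at p *)
Definition field_rep p X (x : V) : V :=
  let q := bwd (chart_at p) x in coord_change q p q (X q).

(* the coordinate vector field of chart_at p with constant components v *)
Definition coord_field p (v : V) : M -> V := fun q => coord_change p q q v.

Definition smooth_fun f p :=
  smooth_near (f \o bwd (chart_at p) : V -> R^o) (fwd (chart_at p) p).

Definition smooth_field X p :=
  smooth_near (field_rep p X) (fwd (chart_at p) p).

(* the derivative v f of f along v in T_pM *)
Definition dirder p (v : V) f : R :=
  'd (f \o bwd (chart_at p) : V -> R^o) (fwd (chart_at p) p) v.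

Definition lie_bracket X Y : M -> V := fun p =>
  'd (field_rep p Y) (fwd (chart_at p) p) (X p)
  - 'd (field_rep p X) (fwd (chart_at p) p) (Y p).

(** Tensor fields *)

(* For fibrewise linear maps, sending smooth fields to smooth objects amounts
   to having smooth components in the charts. *)
Definition covector_field (a : M -> V -> R) :=
  (forall p, scalar (a p)) /\
  (forall X p, smooth_field X p -> smooth_fun (fun q => a q (X q)) p).

Definition bilinear_field (B : M -> V -> V -> R) :=
  [/\ forall p u, scalar (B p u),
      forall p w, scalar (fun u => B p u w)
    & forall X Y p, smooth_field X p -> smooth_field Y p ->
        smooth_fun (fun q => B q (X q) (Y q)) p].

Definition endo_field (T : M -> V -> V) :=
  (forall p, linear (T p)) /\
  (forall X p, smooth_field X p -> smooth_field (fun q => T q (X q)) p).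

Definition two_form (Om : M -> V -> V -> R) :=
  bilinear_field Om /\ (forall p u, Om p u u = 0).

Definition riemannian_metric (g : M -> V -> V -> R) :=
  [/\ bilinear_field g,
      forall p u w, g p u w = g p w u
    & forall p u, u != 0 -> 0 < g p u u].

(** Exterior algebra and exterior derivative *)

Definition form (k : nat) := ('I_k -> V) -> R.

Definition wedge k l (a : form k) (b : form l) : form (k + l) := fun v =>
  (k`! * l`!)%:R^-1 *
  \sum_(s : 'S_(k + l)) (-1) ^+ s *
    (a (fun i => v (s (lshift l i))) * b (fun j => v (s (rshift k j)))).

Fixpoint wedge_pow (w : form 2) (d : nat) : form (d * 2) :=
  if d is d'.+1 then wedge w (@wedge_pow w d') else fun=> 1.

Definition form1 (a : V -> R) : form 1 := fun v => a (v ord0).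
Definition form2 (w : V -> V -> R) : form 2 := fun v => w (v ord0) (v ord_max).

Definition d1 (a : M -> V -> R) X Y p : R :=
  dirder p (X p) (fun q => a q (Y q)) - dirder p (Y p) (fun q => a q (X q))
  - a p (lie_bracket X Y p).

Definition d2 (w : M -> V -> V -> R) X Y Z p : R :=
  dirder p (X p) (fun q => w q (Y q) (Z q))
  - dirder p (Y p) (fun q => w q (X q) (Z q))
  + dirder p (Z p) (fun q => w q (X q) (Y q))
  - w p (lie_bracket X Y p) (Z p)
  + w p (lie_bracket X Z p) (Y p)
  - w p (lie_bracket Y Z p) (X p).

Definition closed_two_form (w : M -> V -> V -> R) :=
  two_form w /\
  forall X Y Z p, smooth_field X p -> smooth_field Y p -> smooth_field Z p ->
    d2 w X Y Z p = 0.

(** Linear connections *)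

(* D p v Y is the covariant derivative of Y along v in T_pM; it is meaningful
   only for Y smooth near p.  It depends only on the germ of Y at p: multiply Y
   by an f equal to 1 near p and to 0 elsewhere, which the Leibniz rule allows
   since f need only be smooth near p.  Hence this is the usual notion of a
   connection acting on local sections. *)
Definition linear_connection (D : forall p, V -> (M -> V) -> V) :=
  [/\ forall p Y, smooth_field Y p -> linear (fun v => D p v Y),
      forall p v Y Z, smooth_field Y p -> smooth_field Z p ->
        D p v (fun q => Y q + Z q) = D p v Y + D p v Z,
      forall p v f Y, smooth_fun f p -> smooth_field Y p ->
        D p v (fun q => f q *: Y q) = dirder p v f *: Y p + f p *: D p v Y
    & forall p X Y, smooth_field X p -> smooth_field Y p ->
        smooth_field (fun q => D q (X q) Y) p].

Definition torsion_free (D : forall p, V -> (M -> V) -> V) :=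
  forall p X Y, smooth_field X p -> smooth_field Y p ->
    D p (X p) Y - D p (Y p) X = lie_bracket X Y p.

Definition dual_connections (g : M -> V -> V -> R)
    (D Ds : forall p, V -> (M -> V) -> V) :=
  forall p X Y Z, smooth_field X p -> smooth_field Y p -> smooth_field Z p ->
    dirder p (X p) (fun q => g q (Y q) (Z q))
    = g p (D p (X p) Y) (Z p) + g p (Y p) (Ds p (X p) Z).

Definition parallel_field (D : forall p, V -> (M -> V) -> V) X :=
  forall p v, D p v X = 0.

Definition parallel_bilinear (D : forall p, V -> (M -> V) -> V)
    (B : M -> V -> V -> R) :=
  forall p X Y Z, smooth_field X p -> smooth_field Y p -> smooth_field Z p ->
    dirder p (X p) (fun q => B q (Y q) (Z q))
    - B p (D p (X p) Y) (Z p) - B p (Y p) (D p (X p) Z) = 0.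

(* self-duality of D with respect to g is metric compatibility *)
Definition levi_civita (g : M -> V -> V -> R)
    (D : forall p, V -> (M -> V) -> V) :=
  [/\ linear_connection D, torsion_free D & dual_connections g D D].

Definition curvature (D : forall p, V -> (M -> V) -> V) X Y Z p : V :=
  D p (X p) (fun q => D q (Y q) Z) - D p (Y p) (fun q => D q (X q) Z)
  - D p (lie_bracket X Y p) Z.

(* The curvature is tensorial, so that at p it may be evaluated on any smooth
   extensions of u, v, w; coordinate fields are used here. *)
Definition ricci (D : forall p, V -> (M -> V) -> V) p (v w : V) : R :=
  \tr (lin1_mx (fun u : V =>
    curvature D (coord_field p u) (coord_field p v) (coord_field p w) p)).

Definition positive_definite (B : M -> V -> V -> R) :=
  forall p v, v != 0 -> 0 < B p v v.

End Manifold.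

Arguments wedge_pow {R n} w d v.

Section StableHamiltonian.
Context {R : realType} {d : nat} {M : manifold R (2 * d)}.
Local Notation V := 'rV[R]_(2 * d).+1.

Definition shs (Om : M -> V -> V -> R) (al : M -> V -> R) :=
  [/\ closed_two_form Om,
      covector_field al,
      forall p, exists v, wedge (form1 (al p)) (wedge_pow (form2 (Om p)) d) v != 0
    & forall p X, smooth_field X p -> (forall w, Om p (X p) w = 0) ->
        forall Y, smooth_field Y p -> d1 al X Y p = 0].

Definition reeb_field (Om : M -> V -> V -> R) (al : M -> V -> R) (E : M -> V) :=
  [/\ forall p, smooth_field E p,
      forall p v, Om p (E p) v = 0
    & forall p, al p (E p) = 1].

Definition compatible_acm (Om : M -> V -> V -> R) (al : M -> V -> R)
    (Th : M -> V -> V) (E : M -> V) (g : M -> V -> V -> R) :=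
  [/\ endo_field Th /\ riemannian_metric g,
      forall p v, Th p (Th p v) = - v + al p v *: E p,
      (forall p, Th p (E p) = 0) /\ (forall p v, al p (Th p v) = 0),
      forall p v, al p v = g p v (E p)
    & forall p u v, g p u v = Om p u (Th p v) + al p u * al p v].

Definition smat_shs_connection (Om : M -> V -> V -> R) (E : M -> V)
    (g : M -> V -> V -> R) (D Ds : forall p : M, V -> (M -> V) -> V) :=
  [/\ linear_connection D /\ linear_connection Ds,
      dual_connections g D Ds,
      torsion_free D,
      parallel_field D E
    & parallel_bilinear D Om].

Definition statistical (D Ds : forall p : M, V -> (M -> V) -> V) :=
  torsion_free D /\ torsion_free Ds.

End StableHamiltonian.

(* Main.v *)
Require Import Defs.
From HB Require Import structures.
From mathcomp Require Import all_boot all_order all_algebra all_fingroup.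
From mathcomp Require Import all_classical all_reals all_analysis.
From mathcomp Require Import ring lra.
Import Order.TTheory GRing.Theory Num.Theory.
Import numFieldNormedType.Exports.
Local Open Scope ring_scope.

(** Why the theorem holds.  At any point the claim is that Ric(E, E) <= 0, where
    E is the Reeb field; since al(E) = 1 makes E nowhere zero, this contradicts
    positivity.

    Suppose D and Ds are both torsion-free.  Then K = Ds - D is a symmetric
    tensor and duality makes g(K_X Y, Z) totally symmetric, while the mean
    (D + Ds) / 2 is metric and torsion-free, hence is the Levi-Civita connection
    LC ([levi_civita_mean]).  As D E = 0, the shape operator A u = LC_u E equals
    half of K_u E = K_E u.  Total symmetry makes A self-adjoint, and g(E, E) = 1
    gives A E = 0.

    The equation D Om = 0 says that duality with respect to g is twisted by Th:
    Ds (Th Z) = Th (D Z) ([Ds_Th]).  Applying it twice and using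
    Th^2 = - 1 + al (x) E gives also D_E (Th Z) = Th (Ds_E Z).  The difference
    and the mean of these two identities say respectively that A anticommutes
    with Th and that LC_E commutes with Th.  Hence the derivative LC_E A
    anticommutes with Th as well, and kills E; such an operator is traceless
    ([tr_anticommute]).

    Since A E = 0, the curvature identity for R(u, E) E reads
    R(u, E) E = - A (A u) - (LC_E A) u.  Taking the trace,
    Ric(E, E) = - tr (A^2), and tr (A^2) >= 0 because A is self-adjoint.

    The Ricci tensor of the statement is computed on coordinate fields, which do
    not agree with E away from the point.  So the argument also needs that the
    curvature is tensorial in its last argument, which rests on the symmetry of
    second derivatives ([diff_diffC]), and the stability of smoothness under
    composition, so that a field that is smooth at a point is smooth at the
    nearby points, each read in its own chart. *)

Set Implicit Arguments.
Unset Strict Implicit.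
Unset Printing Implicit Defensive.

(** * Smooth maps between normed spaces *)

Section Germs.
Local Open Scope classical_set_scope.
Context {R : realType} {V W : normedModType R}.

(** The first-order expansion of f at x is also one of g, since only the germ
    at x matters. *)
Lemma near_eq_is_diff (f g : V -> W) (x : V) :
  (\forall y \near x, f y = g y) -> differentiable f x -> is_diff x g ('d f x).
Proof.
move=> fg df.
have gE : g \o shift x = cst (g x) + 'd f x +o_ 0 id.
  apply/eqaddoP => _/posnumP[e].
  have fo := diff_locally df.
  have /eqaddoP/(_ e%:num (gt0 e)) fe := fo.
  rewrite near_simpl in fe *.
  have fgx : \forall h \near (0 : V), f (h + x) = g (h + x).
    by have := fg; rewrite (near_shift 0 x) subr0.
  have fgx0 := nbhs_singleton fg.
  near=> h.
  have H : `|(f \o shift x - (cst (f x) + 'd f x)) h| <= e%:num * `|h| by near: h.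
  by move: H; rewrite !fctE /= -(near fgx h) // -fgx0.
have gd : 'd g x = 'd f x :> (V -> W).
  by apply: diff_unique gE; exact: diff_continuous.
apply: DiffDef => //; apply/diff_locallyP; rewrite gd; split=> //.
exact: diff_continuous.
Unshelve. all: by end_near. Qed.

(** This makes the product rule for a scalar function times a vector-valued
    one an instance of the differential of a continuous bilinear map. *)
Lemma scaler_is_bilinear :
  bilinear_for
    (GRing.Scale.Law.clone _ _ *:%R _) (GRing.Scale.Law.clone _ _ *:%R _)
    (@GRing.scale R W : R^o -> W -> W).
Proof.
split=> [u'|u] a x y /=.
- by rewrite scalerDl -scalerA.
- by rewrite scalerDr !scalerA mulrC.
Qed.

Lemma is_diff_scale (c : V -> R^o) (f : V -> W) (x : V) :
  differentiable c x -> differentiable f x ->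
  is_diff x (fun y => c y *: f y) (fun v => c x *: 'd f x v + 'd c x v *: f x).
Proof.
move=> /differentiableP dc /differentiableP df.
pose bM := bilinear_isBilinear.Build R R^o W W _ _ _ scaler_is_bilinear.
pose b : {bilinear R^o -> W -> W} := HB.pack (@GRing.scale R W : R^o -> W -> W) bM.
have bc : continuous (fun p : R^o * W => b p.1 p.2) by exact: scale_continuous.
have db : is_diff (c x, f x) (fun p : R^o * W => b p.1 p.2)
   (fun q => b (c x) q.2 + b q.1 (f x)).
  by apply: DiffDef; [exact: differentiable_bilin|rewrite diff_bilin].
exact: (@is_diff_comp _ _ _ _ (fun y => (c y, f y))).
Qed.

End Germs.

Section Ck_theory.
Local Open Scope classical_set_scope.
Context {R : realType} {V : normedModType R}.
Implicit Types (U : set V) (k : nat).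

Lemma open_near U x : open U -> U x -> \forall y \near x, U y.
Proof. by move=> Uo Ux; apply: open_nbhs_nbhs. Qed.

Lemma Ck_eq (W : normedModType R) k U (f g : V -> W) :
  open U -> (forall x, U x -> f x = g x) -> Ck k U f -> Ck k U g.
Proof.
move=> Uo; elim: k f g => [|k IH] f g fg /=.
  move=> fc x Ux; have := fc x Ux; rewrite /prop_for /continuous_at -(fg x Ux).
  apply: cvg_trans; apply: near_eq_cvg.
  by near=> y; rewrite fg //; near: y; exact: open_near.
have fgn x : U x -> \forall y \near x, f y = g y.
  by move=> Ux; near=> y; apply: fg; near: y; exact: open_near.
move=> [fd fk]; have gd x : U x -> is_diff x g ('d f x).
  by move=> Ux; apply: near_eq_is_diff; [exact: fgn|exact: fd].
split=> [x /gd [] //|v]; apply: IH (fk v) => x Ux.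
by have dg := gd x Ux; rewrite diff_val.
Unshelve. all: by end_near. Qed.

Lemma Ck_sub (W : normedModType R) k U U' (f : V -> W) :
  U' `<=` U -> Ck k U f -> Ck k U' f.
Proof.
move=> sU; elim: k f => [|k IH] f /=; first by move=> fc x /sU /fc.
by move=> [fd fk]; split=> [x /sU /fd //|v]; apply: IH.
Qed.

Lemma Ck_pred (W : normedModType R) k U (f : V -> W) : Ck k.+1 U f -> Ck k U f.
Proof.
elim: k f => [|k IH] f.
  by case=> fd _ x Ux; apply: differentiable_continuous; exact: fd.
by move=> [fd fk]; split=> // v; apply: IH; exact: fk.
Qed.

Lemma Ck_cst (W : normedModType R) k U (a : W) : open U -> Ck k U (fun=> a).
Proof.
move=> Uo; elim: k a => [|k IH] a /=; first by move=> x _; exact: cst_continuous.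
split=> [x _|v]; first exact: differentiable_cst.
by apply: (Ck_eq Uo _ (IH 0)) => x _; rewrite diff_cst.
Qed.

Lemma CkD (W : normedModType R) k U (f g : V -> W) : open U ->
  Ck k U f -> Ck k U g -> Ck k U (fun x => f x + g x).
Proof.
move=> Uo; elim: k f g => [|k IH] f g /=.
  by move=> fc gc x Ux; apply: continuousD; [exact: fc|exact: gc].
move=> [fd fk] [gd gk]; split=> [x Ux|v].
  by apply: differentiableD; [exact: fd|exact: gd].
apply: (Ck_eq Uo _ (IH _ _ (fk v) (gk v))) => x Ux.
exact: esym (congr1 (fun F => F v) (diffD (fd x Ux) (gd x Ux))).
Qed.

Lemma Ck_sum (W : normedModType R) k U m (f : 'I_m -> V -> W) : open U ->
  (forall i, Ck k U (f i)) -> Ck k U (fun x => \sum_(i < m) f i x).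
Proof.
move=> Uo fk; elim: m f fk => [|m IH] f fk.
  by apply: (Ck_eq Uo _ (Ck_cst k 0 Uo)) => x _; rewrite big_ord0.
have := CkD Uo (IH _ (fun i => fk (widen_ord (leqnSn m) i))) (fk ord_max).
by apply: Ck_eq => // x _; rewrite big_ord_recr.
Qed.

Lemma CkZ (W : normedModType R) k U (c : V -> R^o) (f : V -> W) : open U ->
  Ck k U c -> Ck k U f -> Ck k U (fun x => c x *: f x).
Proof.
move=> Uo; elim: k c f => [|k IH] c f ck fk.
  move=> x Ux; apply: (@continuous_comp _ _ _ (fun y => (c y, f y) : R^o * W)
    (fun p => p.1 *: p.2)); last exact: scale_continuous.
  exact: cvg_pair (ck x Ux) (fk x Ux).
have [[cd ck'] [fd fk']] := (ck, fk).
have dcf x (Ux : U x) := is_diff_scale (cd x Ux) (fd x Ux).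
split=> [x /dcf [] //|v].
have := CkD Uo (IH _ _ (Ck_pred ck) (fk' v)) (IH _ _ (ck' v) (Ck_pred fk)).
by apply: Ck_eq => // x Ux; have dd := dcf x Ux; rewrite diff_val.
Qed.

Lemma Ck_linear (W W' : normedModType R) (L : {linear W -> W'}) k U (f : V -> W) :
  continuous L -> open U -> Ck k U f -> Ck k U (L \o f).
Proof.
move=> Lc Uo; elim: k f => [|k IH] f.
  by move=> fc x Ux; apply: continuous_comp; [exact: fc|exact: Lc].
move=> [fd fk]; have Ld y : differentiable L y by exact: linear_differentiable.
split=> [x Ux|v]; first by apply: differentiable_comp; [exact: fd|exact: Ld].
apply: (Ck_eq Uo _ (IH _ (fk v))) => x Ux.
by rewrite diff_comp //; [rewrite diff_lin|exact: fd].
Qed.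

Lemma Ck_coord k U m (f : V -> 'rV[R]_m.+1) i : open U ->
  Ck k U f -> Ck k U (fun x => f x 0 i : R^o).
Proof.
move=> Uo fk.
have cl : linear (fun N : 'rV[R]_m.+1 => N 0 i : R^o) by move=> a M N; rewrite !mxE.
pose cM := GRing.isLinear.Build _ _ _ _ _ cl.
pose c : {linear 'rV[R]_m.+1 -> R^o} :=
  HB.pack (fun N : 'rV[R]_m.+1 => N 0 i : R^o) cM.
apply: (@Ck_linear _ _ c k U f) => //; exact: coord_continuous.
Qed.

Lemma linear_sum_delta (W : lmodType R) m (L : {linear 'rV[R]_m -> W}) v :
  L v = \sum_(i < m) v 0 i *: L (delta_mx 0 i).
Proof.
by rewrite {1}[v]row_sum_delta linear_sum; apply: eq_bigr => i _; rewrite linearZ.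
Qed.

End Ck_theory.

(** Expanding the inner differential in the canonical basis turns 'd (f \o g)
    x v into the sum over i of ('d g x v)_i times 'd f (g x) e_i, whose terms
    are C^k by induction. *)
Lemma Ck_comp (R : realType) (V W : normedModType R) m k (U : set V)
    (U' : set 'rV[R]_m.+1) (g : V -> 'rV[R]_m.+1) (f : 'rV[R]_m.+1 -> W) :
  open U -> (forall x, U x -> U' (g x)) -> Ck k U g -> Ck k U' f ->
  Ck k U (f \o g).
Proof.
move=> Uo gU; elim: k f => [|k IH] f gk fk.
  by move=> x Ux; apply: continuous_comp; [exact: gk|apply: fk; exact: gU].
have [[gd gk'] [fd fk']] := (gk, fk).
split=> [x Ux|v].
  by apply: differentiable_comp; [exact: gd|apply: fd; exact: gU].
have H i := CkZ Uo (Ck_coord i Uo (gk' v)) (IH _ (Ck_pred gk) (fk' (delta_mx 0 i))).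
apply: (Ck_eq Uo _ (Ck_sum Uo H)) => x Ux.
by rewrite (diff_comp (gd x Ux) (fd _ (gU _ Ux))) /= [RHS]linear_sum_delta.
Qed.

(** * Symmetry of second derivatives *)

Section Schwarz.
Local Open Scope classical_set_scope.
Context {R : realType} {V : normedModType R}.
Implicit Types (f : V -> R^o) (x v w : V).

Lemma is_derive_line f x v (s : R) : differentiable f (x + s *: v) ->
  is_derive s 1 (fun s => f (x + s *: v) : R) ('d f (x + s *: v) v).
Proof.
move=> /differentiableP df.
have dl : is_diff s (fun t : R => x + t *: v) (fun t : R => t *: v).
  have -> : (fun t : R => x + t *: v) = cst x + ( *:%R ^~ v) by [].
  by apply: is_diff_eq; rewrite add0r.
have dc := is_diff_comp dl df.
apply: DeriveDef; first exact/derivable1_diffP.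
by rewrite deriveE //= diff_val /= scale1r.
Qed.

Lemma mvt_line f x v (h : R) : 0 <= h ->
  (forall s, s \in `[0, h]%R -> differentiable f (x + s *: v)) ->
  exists2 s, s \in `[0, h]%R &
    f (x + h *: v) - f x = 'd f (x + s *: v) v * h.
Proof.
move=> h0 df.
have dl s : s \in `[0, h]%R ->
    is_derive s 1 (fun s => f (x + s *: v) : R) ('d f (x + s *: v) v).
  by move=> /df; exact: is_derive_line.
have dl' s : s \in `]0, h[%R ->
    is_derive s 1 (fun s => f (x + s *: v) : R) ('d f (x + s *: v) v).
  by move=> sh; apply: dl; exact: subset_itv_oo_cc.
have fc : {within `[0, h], continuous (fun s => f (x + s *: v) : R)}.
  by apply: derivable_within_continuous => s sh; have [] := dl s sh.
have := MVT_segment h0 dl' fc.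
by rewrite scale0r addr0 subr0.
Qed.

(** Two applications of the mean value theorem to the second difference of f
    over a parallelogram: first along v to the difference in the direction w,
    then along w to the derivative along v. *)
Lemma second_difference (U : set V) f x v w (h : R) : 0 <= h -> Ck 2 U f ->
  (forall s t, s \in `[0, h]%R -> t \in `[0, h]%R -> U (x + s *: v + t *: w)) ->
  exists s t, [/\ s \in `[0, h]%R, t \in `[0, h]%R &
    f (x + h *: v + h *: w) - f (x + h *: v) - f (x + h *: w) + f x
    = 'd (fun y => 'd f y v : R^o) (x + s *: v + t *: w) w * (h * h)].
Proof.
move=> h0 [fd f2] xU.
have hh : h \in `[0, h]%R by rewrite in_itv /= h0 lexx.
have zh : 0 \in `[0, h]%R by rewrite in_itv /= h0 lexx.
pose g y : R^o := f (y + h *: w) - f y.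
have gd y : U y -> U (y + h *: w) ->
    is_diff y g (fun u => 'd f (y + h *: w) u - 'd f y u).
  move=> /fd/differentiableP d1 /fd/differentiableP d2.
  have dt : is_diff y (fun z => z + h *: w) id.
    have -> : (fun z => z + h *: w) = id + cst (h *: w) by [].
    by apply: is_diff_eq; rewrite addr0.
  by have dc := is_diff_comp dt d2; apply: is_diffB.
have gU s : s \in `[0, h]%R -> U (x + s *: v) /\ U (x + s *: v + h *: w).
  move=> sh; split; last exact: xU.
  by have := xU s 0 sh zh; rewrite scale0r addr0.
have gd' s : s \in `[0, h]%R -> differentiable g (x + s *: v).
  by move=> /gU[sU sU']; have [] := gd _ sU sU'.
have [s sh gE] := mvt_line h0 gd'.
have [sU sU'] := gU s sh.
have fd' t : t \in `[0, h]%R ->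
    differentiable (fun y => 'd f y v : R^o) (x + s *: v + t *: w).
  by move=> th; have [d _] := f2 v; apply: d; exact: xU.
have [t th fE] := mvt_line h0 fd'.
exists s, t; split => //; rewrite mulrA -fE.
have dg := gd _ sU sU'; move: gE; rewrite diff_val => <-.
by rewrite /g; lra.
Qed.

(** The second difference of f over a small parallelogram is symmetric in v
    and w; by [second_difference] it is h^2 times either mixed derivative,
    each at a point close to x, and both are continuous. *)
Lemma diff_diffC (U : set V) f x v w : open U -> U x -> Ck 2 U f ->
  'd (fun y => 'd f y v : R^o) x w = 'd (fun y => 'd f y w : R^o) x v.
Proof.
move=> Uo Ux f2.
apply/eqP; rewrite -subr_eq0 -normr_le0; apply/ler_addgt0Pr => e e0; rewrite add0r.
pose a u u' := fun y => 'd (fun y => 'd f y u : R^o) y u'.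
have ac u u' : {for x, continuous (a u u' : V -> R^o)}.
  by have [_ /(_ u) [_ /(_ u')]] := f2; apply.
have near_a u u' : \forall y \near x, `|a u u' x - a u u' y| < e / 2.
  by have /cvgrPdist_lt := ac u u'; apply; rewrite divr_gt0.
have : \forall y \near x,
    [/\ U y, `|a v w x - a v w y| < e / 2 & `|a w v x - a w v y| < e / 2].
  by near=> y; split; near: y; [exact: open_near|exact: near_a|exact: near_a].
move=> /nbhs_normP [r r0' rP]; have r0 : 0 < r by exact: r0'.
(* The radius r is scaled so that the whole parallelogram lies in the ball. *)
pose c := `|v| + `|w| + 1.
have c0 : 0 < c by rewrite ltr_wpDl // addr_ge0.
pose h := r / (2 * c).
have h0 : 0 < h by rewrite divr_gt0 // mulr_gt0.
have hr s t : s \in `[0, h]%R -> t \in `[0, h]%R -> `|x - (x + s *: v + t *: w)| < r.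
  rewrite !in_itv /= => /andP[s0 sh] /andP[t0 th].
  rewrite -addrA opprD addNKr normrN.
  rewrite (le_lt_trans (ler_normD _ _)) // !normrZ !ger0_norm //.
  apply: (@le_lt_trans _ _ (h * c)); last first.
    by have -> : h * c = r / 2; [rewrite /h; field; rewrite gt_eqF|lra].
  rewrite /c; have := normr_ge0 v; have := normr_ge0 w; nra.
have [s [t [sh th E1]]] : exists s t, [/\ s \in `[0, h]%R, t \in `[0, h]%R &
    f (x + h *: v + h *: w) - f (x + h *: v) - f (x + h *: w) + f x
    = a v w (x + s *: v + t *: w) * (h * h)].
  apply: second_difference f2 _; first exact: ltW.
  by move=> s t sh th; have [] := rP _ (hr s t sh th).
have [s' [t' [sh' th' E2]]] : exists s t, [/\ s \in `[0, h]%R, t \in `[0, h]%R &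
    f (x + h *: w + h *: v) - f (x + h *: w) - f (x + h *: v) + f x
    = a w v (x + s *: w + t *: v) * (h * h)].
  apply: second_difference f2 _; first exact: ltW.
  move=> s' t' sh' th'; rewrite addrAC.
  by have [] := rP _ (hr t' s' th' sh').
have [_ A1 _] := rP _ (hr s t sh th).
have [_ _ A2] := rP _ (hr t' s' th' sh').
have E : a v w (x + s *: v + t *: w) = a w v (x + t' *: v + s' *: w).
  apply: (@mulIf _ (h * h)); first by rewrite mulf_neq0 // gt_eqF.
  by rewrite -E1 [x + t' *: v + _]addrAC -E2 [x + h *: w + _]addrAC; lra.
rewrite -/(a v w x) -/(a w v x).
move: A1 A2; rewrite E; set b := a w v _.
rewrite !ltr_norml !ler_norml => /andP[? ?] /andP[? ?]; apply/andP; split; lra.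
Unshelve. all: by end_near. Qed.
End Schwarz.

(** * Germs of smooth maps *)

Section SmoothNear.
Local Open Scope classical_set_scope.
Context {R : realType} {V : normedModType R}.

Lemma near_open (P : V -> Prop) x : (\forall y \near x, P y) ->
  exists2 A : set V, open_nbhs x A & A `<=` P.
Proof.
move=> Px; exists (interior (P : set V)); last exact: interior_subset.
by split=> //; exact: open_interior.
Qed.

Lemma smooth_near_eq (W : normedModType R) (f g : V -> W) x :
  (\forall y \near x, f y = g y) -> smooth_near f x -> smooth_near g x.
Proof.
move=> /near_open[A [Ao Ax] Afg] [U [Uo Ux] fk].
exists (A `&` U); first by split; [exact: openI|split].
move=> k; apply: (@Ck_eq _ _ _ _ _ f).
- exact: openI.
- by move=> y [/Afg].
- exact: Ck_sub (fk k).
Qed.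

Lemma smooth_near_nbhs (W : normedModType R) (f : V -> W) x :
  smooth_near f x -> \forall y \near x, smooth_near f y.
Proof.
move=> [U Ux fk]; have := open_nbhs_nbhs Ux; apply: filterS => y Uy.
by exists U => //; split=> //; case: Ux.
Qed.

Lemma smooth_near_differentiable (W : normedModType R) (f : V -> W) x :
  smooth_near f x -> differentiable f x.
Proof. by move=> [U [Uo Ux] fk]; have [d _] := fk 1; exact: d. Qed.

Lemma smooth_near_diff (W : normedModType R) (f : V -> W) v x :
  smooth_near f x -> smooth_near (fun y => 'd f y v) x.
Proof.
move=> [U Ux fk]; exists U => // k.
by have [_ fk'] := fk k.+1; exact: fk'.
Qed.

Lemma smooth_near_cst (W : normedModType R) (a : W) (x : V) :
  smooth_near (fun=> a : W) x.
Proof.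
exists setT; last by move=> k; apply: Ck_cst; exact: openT.
by split=> //; exact: openT.
Qed.

Lemma smooth_nearD (W : normedModType R) (f g : V -> W) x :
  smooth_near f x -> smooth_near g x -> smooth_near (fun y => f y + g y) x.
Proof.
move=> [U [Uo Ux] fk] [U' [Uo' Ux'] gk]; have UUo := openI Uo Uo'.
exists (U `&` U') => [//|k]; apply: CkD => //.
- by apply: Ck_sub (fk k) => y [].
- by apply: Ck_sub (gk k) => y [].
Qed.

Lemma smooth_nearZ (W : normedModType R) (c : V -> R^o) (f : V -> W) x :
  smooth_near c x -> smooth_near f x -> smooth_near (fun y => c y *: f y) x.
Proof.
move=> [U [Uo Ux] fk] [U' [Uo' Ux'] gk]; have UUo := openI Uo Uo'.
exists (U `&` U') => [//|k]; apply: CkZ => //.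
- by apply: Ck_sub (fk k) => y [].
- by apply: Ck_sub (gk k) => y [].
Qed.

Lemma smooth_near_sum (W : normedModType R) m (f : 'I_m -> V -> W) x :
  (forall i, smooth_near (f i) x) -> smooth_near (fun y => \sum_(i < m) f i y) x.
Proof.
elim: m f => [|m IH] f fk.
  by apply: smooth_near_eq (smooth_near_cst 0 x); near=> y; rewrite big_ord0.
have := smooth_nearD (IH _ (fun i => fk (widen_ord (leqnSn m) i))) (fk ord_max).
by apply: smooth_near_eq; near=> y; rewrite big_ord_recr.
Unshelve. all: by end_near. Qed.

Lemma smooth_near_coord m (f : V -> 'rV[R]_m.+1) i x :
  smooth_near f x -> smooth_near (fun y => f y 0 i : R^o) x.
Proof.
by move=> [U [Uo Ux] fk]; exists U => // k; exact: Ck_coord.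
Qed.

Lemma smooth_near_continuous (W : normedModType R) (f : V -> W) x :
  smooth_near f x -> {for x, continuous f}.
Proof. by move/smooth_near_differentiable/differentiable_continuous. Qed.

Lemma smooth_near_comp (W : normedModType R) m (g : V -> 'rV[R]_m.+1)
    (f : 'rV[R]_m.+1 -> W) x :
  smooth_near g x -> smooth_near f (g x) -> smooth_near (f \o g) x.
Proof.
move=> gs [U' Ux' fk]; have [U [Uo Ux] gk] := gs.
have : \forall y \near x, U' (g y).
  by apply: smooth_near_continuous gs _ _; exact: open_nbhs_nbhs.
move=> /near_open[A [Ao Ax] AU'].
have UAo := openI Uo Ao; exists (U `&` A) => [//|k].
apply: (@Ck_comp _ _ _ _ _ _ U') => //; first by move=> y [_ /AU'].
by apply: Ck_sub (gk k) => y [].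
Qed.

Lemma near_eq_diff (W : normedModType R) (f g : V -> W) x v :
  (\forall y \near x, f y = g y) -> smooth_near f x -> 'd f x v = 'd g x v.
Proof.
move=> fg /smooth_near_differentiable df.
by have dg := near_eq_is_diff fg df; rewrite [in RHS]diff_val.
Qed.

End SmoothNear.

(** The vector to which the differential is applied may vary with the point:
    expand it in the canonical basis.  This is the shape of every change of
    coordinates of a vector field. *)
Lemma smooth_near_diff_app (R : realType) (V W : normedModType R) m
    (g u : V -> 'rV[R]_m.+1) (f : 'rV[R]_m.+1 -> W) x :
  smooth_near g x -> smooth_near u x -> smooth_near f (g x) ->
  smooth_near (fun y => 'd f (g y) (u y)) x.
Proof.
move=> gs us fs.
have := smooth_near_sum (fun i => smooth_nearZ (smooth_near_coord i us)
  (smooth_near_comp gs (smooth_near_diff (delta_mx 0 i) fs))).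
by apply: smooth_near_eq; near=> y; rewrite [RHS]linear_sum_delta.
Unshelve. all: by end_near. Qed.

(** * Charts, tangent vectors and vector fields *)

Section Charts.
Local Open Scope classical_set_scope.
Context {R : realType} {n : nat} {M : manifold R n}.
Local Notation V := 'rV[R]_n.+1.
Implicit Types (a b c p q : M) (X Y Z : M -> V) (f : M -> R).
Local Notation dm a := (Defs.dom (chart_at a)).
Local Notation fw a := (fwd (chart_at a)).
Local Notation bw a := (bwd (chart_at a)).
Local Notation tr a b := (fw b \o bw a).

Lemma near_dom a q : dm a q -> \forall r \near q, dm a r.
Proof. by move=> aq; apply: open_nbhs_nbhs; split=> //; exact: dom_open. Qed.

Lemma near_bwd a q (P : M -> Prop) : dm a q ->
  (\forall r \near q, P r) -> \forall x \near fw a q, P (bw a x).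
Proof.
move=> aq Pq; apply: (bwd_continuous (fwd_img aq)).
by rewrite /= fwdK.
Qed.

Lemma near_fwd a q (P : V -> Prop) : dm a q ->
  (\forall x \near fw a q, P x) -> \forall r \near q, P (fw a r).
Proof. by move=> aq Pq; apply: (fwd_continuous aq). Qed.

Lemma near_bwdK a q : dm a q -> \forall x \near fw a q, fw a (bw a x) = x.
Proof.
move=> aq; have : open_nbhs (fw a q) (img (chart_at a)).
  by split; [exact: img_open|exact: fwd_img].
by move=> /open_nbhs_nbhs; apply: filterS => x; exact: bwdK.
Qed.

Lemma smooth_transition a b q : dm a q -> dm b q -> smooth_near (tr a b) (fw a q).
Proof. exact: chart_compat. Qed.

Lemma transition_fwd a b q : dm a q -> tr a b (fw a q) = fw b q.
Proof. by move=> aq; rewrite /= fwdK. Qed.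

Lemma coord_change_id a q v : dm a q -> coord_change a a q v = v.
Proof.
move=> aq; rewrite /coord_change -(@near_eq_diff _ _ _ id).
- by have [_ ->] := is_diff_id (fw a q).
- by apply: filterS (near_bwdK aq) => x /= ->.
- apply: smooth_near_eq (smooth_transition aq aq).
  by apply: filterS (near_bwdK aq) => x /= ->.
Qed.

(** The chain rule for the transition maps: the identifications of tangent
    vectors read in different charts form a cocycle. *)
Lemma coord_change_comp a b c q v : dm a q -> dm b q -> dm c q ->
  coord_change b c q (coord_change a b q v) = coord_change a c q v.
Proof.
move=> aq bq cq; have sab := smooth_transition aq bq.
have sbc : smooth_near (tr b c) (tr a b (fw a q)).
  by rewrite transition_fwd //; exact: smooth_transition.
have dc := diff_comp (smooth_near_differentiable sab)
  (smooth_near_differentiable sbc).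
transitivity ('d (tr b c \o tr a b) (fw a q) v); first by rewrite dc /= fwdK.
apply: near_eq_diff; last exact: smooth_near_comp.
apply: filterS (near_bwd aq (near_dom bq)) => x bx.
by rewrite /= fwdK.
Qed.

Lemma smooth_fun_chart f a b q : dm a q -> dm b q ->
  smooth_near (f \o bw a : V -> R^o) (fw a q) ->
  smooth_near (f \o bw b : V -> R^o) (fw b q).
Proof.
move=> aq bq fs.
have : smooth_near ((f \o bw a : V -> R^o) \o tr b a) (fw b q).
  by apply: smooth_near_comp; [exact: smooth_transition|rewrite transition_fwd].
apply: smooth_near_eq; apply: filterS (near_bwd bq (near_dom aq)) => x ax.
by rewrite /= fwdK.
Qed.

(** Smoothness at q is tested in the chart chosen at q, not in the one at p,
    so this rests on the compatibility of the charts. *)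
Lemma smooth_fun_near f p : smooth_fun f p -> \forall q \near p, smooth_fun f q.
Proof.
have pp := chart_at_dom p.
move=> /smooth_near_nbhs/(near_fwd pp) fs.
have pd := near_dom pp; near=> q.
apply: (@smooth_fun_chart _ p); [by near: q|exact: chart_at_dom|].
by near: q.
Unshelve. all: by end_near. Qed.

Lemma smooth_fun_eq f g p : (\forall q \near p, f q = g q) ->
  smooth_fun f p -> smooth_fun g p.
Proof.
by move=> fg; apply: smooth_near_eq; exact: (near_bwd (chart_at_dom p) fg).
Qed.

Lemma dirder_eq f g p v : (\forall q \near p, f q = g q) ->
  smooth_fun f p -> dirder p v f = dirder p v g.
Proof.
by move=> fg; apply: near_eq_diff; exact: (near_bwd (chart_at_dom p) fg).
Qed.

(** The chain rule: the derivative of f along a tangent vector can be computed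
    in any chart around the point. *)
Lemma dirder_chart f a q v : dm a q -> smooth_fun f q ->
  dirder q (coord_change a q q v) f = 'd (f \o bw a : V -> R^o) (fw a q) v.
Proof.
move=> aq fs; have qq := chart_at_dom q.
have sa := smooth_transition aq qq.
have fs' : smooth_near (f \o bw q : V -> R^o) (tr a q (fw a q)).
  by rewrite transition_fwd.
have dc := diff_comp (smooth_near_differentiable sa) (smooth_near_differentiable fs').
transitivity ('d ((f \o bw q : V -> R^o) \o tr a q) (fw a q) v).
  by rewrite dc /= /dirder fwdK.
apply: near_eq_diff; last exact: smooth_near_comp.
apply: filterS (near_bwd aq (near_dom qq)) => x qx.
by rewrite /= fwdK.
Qed.

Lemma smooth_field_chart X a b q : dm a q -> dm b q ->
  smooth_near (field_rep a X) (fw a q) -> smooth_near (field_rep b X) (fw b q).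
Proof.
move=> aq bq Xs.
have sba := smooth_transition bq aq.
have : smooth_near
    (fun x => 'd (tr a b) (tr b a x) (field_rep a X (tr b a x))) (fw b q).
  apply: smooth_near_diff_app => //.
    apply: (@smooth_near_comp _ _ _ _ _ (field_rep a X)) => //.
    by rewrite transition_fwd.
  by rewrite transition_fwd //; exact: smooth_transition.
apply: smooth_near_eq.
near=> x.
have ax : dm a (bw b x) by near: x; exact: (near_bwd bq (near_dom _)).
have bx : dm b (bw b x) by near: x; exact: (near_bwd bq (near_dom _)).
rewrite /field_rep /= fwdK // -/(coord_change a b (bw b x) _).
by apply: coord_change_comp => //; exact: chart_at_dom.
Unshelve. all: by end_near. Qed.

(** As for functions, but the components of the field also change with the
    chart, through the differential of the transition map. *)
Lemma smooth_field_near X p : smooth_field X p -> \forall q \near p, smooth_field X q.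
Proof.
have pp := chart_at_dom p.
move=> /smooth_near_nbhs/(near_fwd pp) fs.
have pd := near_dom pp; near=> q.
apply: (@smooth_field_chart _ p); [by near: q|exact: chart_at_dom|].
by near: q.
Unshelve. all: by end_near. Qed.

Lemma smooth_field_eq X Y p : (\forall q \near p, X q = Y q) ->
  smooth_field X p -> smooth_field Y p.
Proof.
move=> XY; apply: smooth_near_eq.
apply: filterS (near_bwd (chart_at_dom p) XY) => x.
by rewrite /field_rep => ->.
Qed.

Lemma smooth_fieldD X Y p : smooth_field X p -> smooth_field Y p ->
  smooth_field (fun q => X q + Y q) p.
Proof.
move=> Xs Ys; apply: smooth_near_eq (smooth_nearD Xs Ys).
by near=> x; rewrite /field_rep /coord_change linearD.
Unshelve. all: by end_near. Qed.

Lemma smooth_fieldZ f X p : smooth_fun f p -> smooth_field X p ->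
  smooth_field (fun q => f q *: X q) p.
Proof.
move=> Xs Ys; apply: smooth_near_eq (smooth_nearZ Xs Ys).
by near=> x; rewrite /field_rep /coord_change linearZ.
Unshelve. all: by end_near. Qed.

Lemma smooth_field0 p : smooth_field (fun=> 0) p.
Proof.
apply: smooth_near_eq (smooth_near_cst 0 _).
by near=> x; rewrite /field_rep /coord_change linear0.
Unshelve. all: by end_near. Qed.

Lemma smooth_fun_cst (r : R) p : smooth_fun (fun=> r) p.
Proof. exact: smooth_near_cst. Qed.

Lemma dirder_cst (r : R) p v : dirder p v (fun=> r) = 0.
Proof. by rewrite /dirder diff_cst. Qed.

Lemma dirderN f p v :
  smooth_fun f p -> dirder p v (fun q => - f q) = - dirder p v f.
Proof.
move=> /smooth_near_differentiable fd; rewrite /dirder.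
by rewrite -[_ \o _]/(- (f \o bwd (chart_at p) : _ -> R^o)) diffN.
Qed.

Lemma field_rep_coord_field p v :
  \forall x \near fw p p, field_rep p (coord_field p v) x = v.
Proof.
have pp := chart_at_dom p.
apply: filterS (near_bwd pp (near_dom pp)) => x px.
rewrite /field_rep /coord_field coord_change_comp ?coord_change_id //.
exact: chart_at_dom.
Qed.

Lemma smooth_coord_field p v : smooth_field (coord_field p v) p.
Proof.
apply: smooth_near_eq (smooth_near_cst v _).
by apply: filterS (field_rep_coord_field p v) => x ->.
Qed.

Lemma coord_field_id p v : coord_field p v p = v.
Proof. by rewrite /coord_field coord_change_id //; exact: chart_at_dom. Qed.

Lemma lie_bracket_coord_field p u v :
  lie_bracket (coord_field p u) (coord_field p v) p = 0.
Proof.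
have d0 w w' : 'd (field_rep p (coord_field p w)) (fw p p) w' = 0.
  rewrite -(@near_eq_diff _ _ _ (cst w)); first by rewrite diff_cst.
    by apply: filterS (field_rep_coord_field p w) => x ->.
  exact: smooth_near_cst.
by rewrite -[RHS](subrr 0); congr (_ - _); [exact: d0 v _|exact: d0 u _].
Qed.

(** The components of X in the coordinate frame of the chart chosen at p. *)
Definition field_coord p X (i : 'I_n.+1) : M -> R :=
  fun q => field_rep p X (fw p q) 0 i.

Lemma smooth_field_coord p X i : smooth_field X p -> smooth_fun (field_coord p X i) p.
Proof.
move=> Xs; apply: smooth_near_eq (smooth_near_coord i Xs).
by apply: filterS (near_bwdK (chart_at_dom p)) => x /= e; rewrite /field_coord e.
Qed.

Lemma field_coord_id p X i : field_coord p X i p = X p 0 i.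
Proof.
have pp := chart_at_dom p.
by rewrite /field_coord /field_rep fwdK // coord_change_id.
Qed.

(** Near p a field is a combination, with smooth coefficients, of the
    coordinate fields of the chart at p.  Tensoriality is reduced to this. *)
Lemma frame_expansion p X : \forall q \near p,
  \sum_(i < n.+1) field_coord p X i q *: coord_field p (delta_mx 0 i) q = X q.
Proof.
have pp := chart_at_dom p; apply: filterS (near_dom pp) => q pq.
have qq := chart_at_dom q.
rewrite /field_coord /coord_field /coord_change -linear_sum_delta /field_rep fwdK //.
by rewrite -/(coord_change p q q _) coord_change_comp // coord_change_id.
Qed.

Lemma dirder_coord_field_near f p v : smooth_fun f p -> \forall q \near p,
  dirder q (coord_field p v q) f = 'd (f \o bw p : V -> R^o) (fw p q) v.
Proof.
move=> fs; have pd := near_dom (chart_at_dom p); have fn := smooth_fun_near fs.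
by near=> q; apply: dirder_chart; near: q.
Unshelve. all: by end_near. Qed.

Lemma dirder_coord_field_repr f p v : smooth_fun f p ->
  \forall x \near fw p p,
    'd (f \o bw p : V -> R^o) x v
    = ((fun q => dirder q (coord_field p v q) f) \o bw p) x.
Proof.
move=> fs; have pp := chart_at_dom p.
have H := near_bwd pp (dirder_coord_field_near v fs).
have K := near_bwdK pp.
near=> x.
have e : fw p (bw p x) = x by near: x.
have hx : dirder (bw p x) (coord_field p v (bw p x)) f
    = 'd (f \o bw p : V -> R^o) (fw p (bw p x)) v by near: x; exact: H.
by rewrite e in hx; exact: esym hx.
Unshelve. all: by end_near. Qed.

Lemma smooth_dirder_coord_field f p v : smooth_fun f p ->
  smooth_fun (fun q => dirder q (coord_field p v q) f) p.
Proof.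
move=> fs; apply: smooth_near_eq (smooth_near_diff v fs).
exact: dirder_coord_field_repr.
Qed.

(** Coordinate derivations commute, by the symmetry of second derivatives in
    the chart at p. *)
Lemma dirder_comm f p u v : smooth_fun f p ->
  dirder p u (fun q => dirder q (coord_field p v q) f)
  = dirder p v (fun q => dirder q (coord_field p u q) f).
Proof.
move=> fs.
have dE w w' : dirder p w' (fun q => dirder q (coord_field p w q) f)
    = 'd (fun x => 'd (f \o bw p : V -> R^o) x w : R^o) (fw p p) w'.
  apply/esym/near_eq_diff; first exact: dirder_coord_field_repr.
  exact: smooth_near_diff.
have [U [Uo Ux] fk] := fs.
by rewrite !dE; exact: diff_diffC Uo Ux (fk 2).
Qed.

End Charts.

(** * Linear algebra *)

Section LinearProp.
Context {R : realType} {n : nat}.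
Local Notation V := 'rV[R]_n.

Lemma linear_propD (f : V -> V) : linear f -> {morph f : u v / u + v}.
Proof. by move=> fl u v; have := fl 1 u v; rewrite !scale1r. Qed.

Lemma linear_prop0 (f : V -> V) : linear f -> f 0 = 0.
Proof. by move=> fl; have := fl (-1) 0 0; rewrite !scaleN1r oppr0 addr0 addNr. Qed.

Lemma linear_propZ (f : V -> V) : linear f -> forall a u, f (a *: u) = a *: f u.
Proof. by move=> fl a u; have := fl a u 0; rewrite (linear_prop0 fl) !addr0. Qed.

Lemma linear_propN (f : V -> V) : linear f -> {morph f : u / - u}.
Proof. by move=> fl u; rewrite -scaleN1r (linear_propZ fl) scaleN1r. Qed.

Lemma scalar_propD (f : V -> R) : scalar f -> {morph f : u v / u + v}.
Proof. by move=> fl u v; have := fl 1 u v; rewrite scale1r mul1r. Qed.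

Lemma scalar_prop0 (f : V -> R) : scalar f -> f 0 = 0.
Proof.
move=> fl; have := fl (-1) 0 0.
by rewrite !scaleN1r oppr0 addr0 mulN1r addNr.
Qed.

Lemma scalar_propZ (f : V -> R) : scalar f -> forall a u, f (a *: u) = a * f u.
Proof. by move=> fl a u; have := fl a u 0; rewrite (scalar_prop0 fl) !addr0. Qed.

Lemma scalar_propN (f : V -> R) : scalar f -> {morph f : u / - u}.
Proof. by move=> fl u; rewrite -scaleN1r (scalar_propZ fl) mulN1r. Qed.

Lemma scalar_sum_delta (f : V -> R) u : scalar f ->
  f u = \sum_(i < n) u 0 i * f (delta_mx 0 i).
Proof.
move=> fl; pose fM := GRing.isLinear.Build R V R *%R f fl.
pose L : {scalar V} := HB.pack f fM.
rewrite -[f u]/(L u) {1}[u]row_sum_delta linear_sum.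
by apply: eq_bigr => i _; rewrite linearZ.
Qed.

Lemma tr_lin1 (f : V -> V) : \tr (lin1_mx f) = \sum_(i < n) f (delta_mx 0 i) 0 i.
Proof. by apply: eq_bigr => i _; rewrite mxE. Qed.

End LinearProp.

Section Helpers.

Lemma mx_entry_delta (R : nzRingType) m n (X : 'M[R]_(m, n)) i j :
  X i j = ((delta_mx 0 i : 'rV_m) *m X *m (delta_mx 0 j : 'rV_n)^T) 0 0.
Proof. by rewrite -rowE trmx_delta -colE !mxE. Qed.

Lemma sub_exchange (W : zmodType) (a b c d : W) : a - b = c - d -> c - a = d - b.
Proof. by move=> /(canRL (subrK _)) ->; rewrite opprD addrA subKr. Qed.

Lemma sub_mean (R : pzRingType) (W : lmodType R) (a a' b b' l l' : W) :
  a - a' = l - l' -> b - b' = l - l' ->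
  a + b - 2%:R *: l = a' + b' - 2%:R *: l'.
Proof.
move=> /(canRL (subrK _)) -> /(canRL (subrK _)) ->.
rewrite addrACA -mulr2n -scaler_nat scalerBr addrAC [2%:R *: l - _]addrC addrK.
exact: addrC.
Qed.

Lemma sub_common (W : zmodType) (a b c d d' : W) :
  a + b + (c + d) - (a + c + (b + d')) = d - d'.
Proof.
rewrite [a + b + _]addrACA opprD [LHS]addrACA subrr add0r opprD addrACA.
by rewrite subrr add0r.
Qed.

End Helpers.

Section LinearAlgebra.
Context {R : realType}.

Lemma lin1_mxE m n (f : 'rV[R]_m -> 'rV[R]_n) u : linear f -> u *m lin1_mx f = f u.
Proof.
move=> fl; pose fM := GRing.isLinear.Build _ _ _ _ _ fl.
pose L : {linear 'rV[R]_m -> 'rV[R]_n} := HB.pack f fM.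
exact: (mul_rV_lin1 L).
Qed.

Lemma eq_mul_rV m n (A B : 'M[R]_(m, n)) :
  (forall u : 'rV_m, u *m A = u *m B) -> A = B.
Proof. by move=> AB; apply/row_matrixP => i; rewrite !rowE AB. Qed.

(** Induction on the size: the Schur complement of a positive diagonal entry
    is again symmetric and positive definite. *)
Lemma cholesky n (G : 'M[R]_n) : G^T = G ->
  (forall u : 'rV_n, u != 0 -> 0 < (u *m G *m u^T) 0 0) ->
  exists L : 'M[R]_n, G = L *m L^T.
Proof.
elim: n G => [|n IH] G.
  by move=> _ _; exists 0; rewrite [RHS]flatmx0 [LHS]flatmx0.
rewrite -[n.+1]/(1 + n)%N in G *.
rewrite -[G]submxK; set a := ulsubmx G; set b := ursubmx G.
set c := dlsubmx G; set C := drsubmx G.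
rewrite tr_block_mx => /eq_block_mx [aT cb _ CT] Gpos.
have {}cb : c = b^T by rewrite -cb trmxK.
rewrite cb in Gpos *.
have aE : a = (a 0 0)%:M by exact: mx11_scalar.
have a0 : 0 < a 0 0.
  have := Gpos (row_mx 1 0); rewrite mul_row_block tr_row_mx mul_row_col.
  rewrite !mul0mx !mul1mx !addr0 trmx0 mulmx0 addr0 trmx1 mulmx1; apply.
  apply/eqP => /(congr1 lsubmx); rewrite row_mxKl lsubmx_const.
  by move=> /matrixP/(_ 0 0); rewrite !mxE eqxx => /eqP; rewrite oner_eq0.
(* The Schur complement of the corner entry. *)
pose S := C - (a 0 0)^-1 *: (b^T *m b).
have Ssym : S^T = S by rewrite linearB linearZ /= trmx_mul trmxK CT.
have Spos (u : 'rV_n) : u != 0 -> 0 < (u *m S *m u^T) 0 0.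
  move=> u0; pose x := - (a 0 0)^-1 *: (u *m b^T).
  have xa : x *m a + u *m b^T = 0.
    by rewrite aE mul_mx_scalar /x scalerA mulrN divff ?gt_eqF // scaleN1r addNr.
  have xu0 : row_mx x u != 0.
    by apply: contra u0 => /eqP/(congr1 rsubmx); rewrite row_mxKr linear0 => ->.
  have := Gpos _ xu0; rewrite mul_row_block tr_row_mx mul_row_col xa mul0mx add0r.
  rewrite (_ : x *m b + u *m C = u *m S) //.
  by rewrite /S mulmxBr -scalemxAr /x -scalemxAl scaleNr addrC mulmxA.
have [L' SE] := IH S Ssym Spos.
pose s := Num.sqrt (a 0 0).
have s0 : s != 0 by rewrite gt_eqF // sqrtr_gt0.
have ss : s * s = a 0 0 by rewrite -expr2 sqr_sqrtr // ltW.
exists (block_mx s%:M 0 (s^-1 *: b^T) L').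
rewrite tr_block_mx mulmx_block !tr_scalar_mx !trmx0 linearZ /= trmxK.
rewrite !mul0mx !mulmx0 !addr0 !mul_scalar_mx !mul_mx_scalar !scalerA divff //.
rewrite !scale1r -scalemxAl -scalemxAr scalerA -SE -invfM ss /S addrC subrK.
by rewrite {1}aE -ss scale_scalar_mx.
Qed.

(** If G = L L^T, conjugating A by L gives a symmetric matrix B, and tr (A^2)
    = tr (B B^T) is a sum of squares. *)
Lemma tr_self_adjoint_sq n (G A : 'M[R]_n) : G^T = G ->
  (forall u : 'rV_n, u != 0 -> 0 < (u *m G *m u^T) 0 0) ->
  A *m G = G *m A^T -> 0 <= \tr (A *m A).
Proof.
move=> Gs Gpos AG; have [L GE] := cholesky Gs Gpos.
have Lu : L \in unitmx.
  rewrite -row_free_unit -kermx_eq0; apply/eqP/row_matrixP => i.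
  rewrite row0; apply/eqP/negPn/negP => /Gpos.
  rewrite GE mulmxA; have /sub_kermxP -> := row_sub i (kermx L).
  by rewrite !mul0mx mxE ltxx.
have ALE : invmx L *m A *m L = (invmx L *m A *m L)^T.
  rewrite !trmx_mul trmx_inv.
  apply: (can_inj (mulKmx Lu)).
  apply: (can_inj (mulmxK (_ : L^T \in unitmx))); first by rewrite unitmx_tr.
  rewrite !mulmxA mulmxV // mul1mx -[A *m L *m _]mulmxA -GE AG GE.
  by rewrite -!mulmxA mulVmx ?unitmx_tr // mulmx1.
set B := invmx L *m A *m L in ALE.
have -> : \tr (A *m A) = \tr (B *m B^T).
  rewrite -ALE /B !mulmxA -[_ *m L *m _ in RHS]mulmxA mulmxV // mulmx1.
  by rewrite [RHS]mxtrace_mulC !mulmxA mulmxV // mul1mx.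
rewrite /mxtrace sumr_ge0 // => i _; rewrite mxE sumr_ge0 // => j _.
by rewrite !mxE -expr2 sqr_ge0.
Qed.

(** On the one hand B = - B T T, because B kills e; on the other hand tr (B T
    T) = - tr (T B T) = - tr (B T T) by cyclicity of the trace. *)
Lemma tr_anticommute n (B T : 'rV[R]_n -> 'rV[R]_n) (al : 'rV[R]_n -> R) e :
  linear B -> linear T -> (forall v, T (T v) = - v + al v *: e) ->
  (forall v, B (T v) = - T (B v)) -> B e = 0 -> \tr (lin1_mx B) = 0.
Proof.
move=> Bl Tl TT BT Be; set b := lin1_mx B; pose t := lin1_mx T.
have tb : t *m b = - (b *m t).
  by apply: eq_mul_rV => u; rewrite mulmxN !mulmxA !lin1_mxE.
have bE : b = - (t *m t *m b).
  apply: eq_mul_rV => u; rewrite mulmxN !mulmxA !lin1_mxE // TT.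
  have := Bl (al u) e (- u); rewrite Be scaler0 add0r addrC => ->.
  have := Bl (-1) u 0; rewrite !scaleN1r addr0 => ->.
  have := Bl (-1) 0 0; rewrite scaler0 addr0 scaleN1r addNr => ->.
  by rewrite addr0 opprK.
have ttb : \tr (t *m t *m b) = - \tr (t *m t *m b).
  rewrite -{1}mulmxA tb mulmxN raddfN /=; congr (- _).
  by rewrite mulmxA mxtrace_mulC mulmxA.
rewrite bE raddfN /=; apply/eqP; rewrite oppr_eq0 -[_ == _](@mulrn_eq0 _ _ 2).
by rewrite mulr2n {1}ttb addNr.
Qed.
End LinearAlgebra.

(** * Tensoriality *)

Section Tensoriality.
Local Open Scope classical_set_scope.
Context {R : realType} {n : nat} {M : manifold R n}.
Local Notation V := 'rV[R]_n.+1.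
Implicit Types (p q : M) (X Y Z U : M -> V) (f : M -> R).

Section Bump.
Context (X Y : M -> V) (p : M).
Let bump q : R := if `[< X q = Y q >] then 1 else 0.

Let bump_near : (\forall q \near p, X q = Y q) -> \forall q \near p, bump q = 1.
Proof. by apply: filterS => q XY; rewrite /bump asboolT. Qed.

(** A witness is the indicator function of the set where X and Y agree: it is
    smooth at p because it is constant near p.  It shows that operators
    obeying a Leibniz rule only depend on germs. *)
Lemma germ_bump : (\forall q \near p, X q = Y q) ->
  exists f, [/\ smooth_fun f p, f p = 1, forall v, dirder p v f = 0 &
    (fun q => f q *: X q) = (fun q => f q *: Y q)].
Proof.
move=> XY; have b1 := bump_near XY.
have b1' : \forall q \near p, 1 = bump q by apply: filterS b1 => q ->.
exists bump; split.
- exact: smooth_fun_eq b1' (smooth_fun_cst 1 p).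
- exact: nbhs_singleton b1.
- by move=> v; rewrite -(dirder_eq v b1' (smooth_fun_cst 1 p)) dirder_cst.
- apply/funext => q; rewrite /bump; case: asboolP => [->//|_].
  by rewrite !scale0r.
Qed.
End Bump.

(** An operator that is linear over the functions smooth at p only sees germs
    at p, by [germ_bump]; on the frame expansion of X it then only sees the
    coefficients at p. *)
Lemma tensorial_frame (F : (M -> V) -> V) p :
  (forall X Y, smooth_field X p -> smooth_field Y p ->
    F (fun q => X q + Y q) = F X + F Y) ->
  (forall f X, smooth_fun f p -> smooth_field X p ->
    F (fun q => f q *: X q) = f p *: F X) ->
  forall X, smooth_field X p ->
    F X = \sum_(i < n.+1) X p 0 i *: F (coord_field p (delta_mx 0 i)).
Proof.
move=> FD FZ.
have Fgerm X Y : smooth_field X p -> (\forall q \near p, X q = Y q) -> F X = F Y.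
  move=> Xs XY; have Ys := smooth_field_eq XY Xs.
  have [f [fs f1 _ fXY]] := germ_bump XY.
  have := FZ f X fs Xs; rewrite f1 scale1r => <-.
  by rewrite fXY FZ // f1 scale1r.
have F0 : F (fun=> 0) = 0.
  have := FZ (fun=> 0) _ (smooth_fun_cst 0 p) (smooth_field0 p).
  by rewrite /= !scale0r.
have Fsum m (Y : 'I_m -> M -> V) : (forall i, smooth_field (Y i) p) ->
    smooth_field (fun q => \sum_(i < m) Y i q) p /\
    F (fun q => \sum_(i < m) Y i q) = \sum_(i < m) F (Y i).
  elim: m Y => [|m IH] Y Ys.
    have -> : (fun q => \sum_(i < 0) Y i q) = fun=> 0.
      by apply/funext => q; rewrite big_ord0.
    by rewrite big_ord0; split=> //; exact: smooth_field0.
  have [s e] := IH (fun i => Y (widen_ord (leqnSn m) i)) (fun i => Ys _).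
  have -> : (fun q => \sum_(i < m.+1) Y i q) = fun q =>
      (\sum_(i < m) Y (widen_ord (leqnSn m) i) q) + Y ord_max q.
    by apply/funext => q; rewrite big_ord_recr.
  by rewrite big_ord_recr /= -e -FD //; split=> //; exact: smooth_fieldD.
move=> X Xs.
have Ys i : smooth_field
    (fun q => field_coord p X i q *: coord_field p (delta_mx 0 i) q) p.
  by apply: smooth_fieldZ; [exact: smooth_field_coord|exact: smooth_coord_field].
have [s e] := Fsum _ _ Ys.
rewrite -(Fgerm _ _ s (frame_expansion p X)) e; apply: eq_bigr => i _.
rewrite FZ ?field_coord_id //; first exact: smooth_field_coord.
exact: smooth_coord_field.
Qed.

Lemma tensorial_eq (F : (M -> V) -> V) p :
  (forall X Y, smooth_field X p -> smooth_field Y p ->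
    F (fun q => X q + Y q) = F X + F Y) ->
  (forall f X, smooth_fun f p -> smooth_field X p ->
    F (fun q => f q *: X q) = f p *: F X) ->
  forall X Y, smooth_field X p -> smooth_field Y p -> X p = Y p -> F X = F Y.
Proof.
by move=> FD FZ X Y Xs Ys XY; rewrite !(tensorial_frame FD FZ) // XY.
Qed.

End Tensoriality.

(** * Connections and curvature *)

Section Connections.
Local Open Scope classical_set_scope.
Context {R : realType} {n : nat} {M : manifold R n}.
Local Notation V := 'rV[R]_n.+1.
Implicit Types (p q : M) (X Y Z U : M -> V) (f : M -> R).
Variables (D : forall p : M, V -> (M -> V) -> V) (hD : linear_connection D).

Lemma conn_linear p Y : smooth_field Y p -> linear (fun v => D p v Y).
Proof. by case: hD => + _ _ _; exact. Qed.

Lemma connD p v Y Z : smooth_field Y p -> smooth_field Z p ->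
  D p v (fun q => Y q + Z q) = D p v Y + D p v Z.
Proof. by case: hD => _ + _ _; exact. Qed.

Lemma conn_leibniz p v f Y : smooth_fun f p -> smooth_field Y p ->
  D p v (fun q => f q *: Y q) = dirder p v f *: Y p + f p *: D p v Y.
Proof. by case: hD => _ _ + _; exact. Qed.

Lemma conn_smooth p X Y : smooth_field X p -> smooth_field Y p ->
  smooth_field (fun q => D q (X q) Y) p.
Proof. by case: hD => _ _ _; exact. Qed.

Lemma conn_germ p v X Y : smooth_field X p -> (\forall q \near p, X q = Y q) ->
  D p v X = D p v Y.
Proof.
move=> Xs XY; have Ys := smooth_field_eq XY Xs.
have [f [fs f1 df fXY]] := germ_bump XY.
have := conn_leibniz v fs Xs; have := conn_leibniz v fs Ys.
by rewrite fXY df f1 !scale0r !add0r !scale1r => -> ->.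
Qed.

Lemma conn_const p v (r : R) Y : smooth_field Y p ->
  D p v (fun q => r *: Y q) = r *: D p v Y.
Proof.
move=> Ys; rewrite (conn_leibniz v (smooth_fun_cst r p) Ys).
by rewrite dirder_cst scale0r add0r.
Qed.

Lemma conn_zero_field p v : D p v (fun=> 0) = 0.
Proof.
by have := conn_const v 0 (smooth_field0 p); rewrite /= !scale0r.
Qed.

Lemma second_derivD p w U Y Z : smooth_field U p -> smooth_field Y p ->
  smooth_field Z p ->
  D p w (fun q => D q (U q) (fun r => Y r + Z r))
  = D p w (fun q => D q (U q) Y) + D p w (fun q => D q (U q) Z).
Proof.
move=> Us Ys Zs; rewrite -connD; [|exact: conn_smooth|exact: conn_smooth].
apply: conn_germ; first by apply: conn_smooth => //; exact: smooth_fieldD.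
by apply: filterS2 (smooth_field_near Ys) (smooth_field_near Zs) => q; exact: connD.
Qed.

(** The two terms of first order in f are exchanged when w and U p are; the
    one of second order is symmetric when the two derivations commute. *)
Lemma second_deriv_leibniz p w U f Y : smooth_field U p -> smooth_fun f p ->
  smooth_field Y p -> smooth_fun (fun q => dirder q (U q) f) p ->
  D p w (fun q => D q (U q) (fun r => f r *: Y r))
  = dirder p w (fun q => dirder q (U q) f) *: Y p + dirder p (U p) f *: D p w Y
    + (dirder p w f *: D p (U p) Y + f p *: D p w (fun q => D q (U q) Y)).
Proof.
move=> Us fs Ys dfs.
have UYs := conn_smooth Us Ys.
rewrite -(conn_leibniz w fs UYs) -(conn_leibniz w dfs Ys).
rewrite -connD; [|exact: smooth_fieldZ|exact: smooth_fieldZ].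
apply: conn_germ; first by apply: conn_smooth => //; exact: smooth_fieldZ.
apply: filterS2 (smooth_fun_near fs) (smooth_field_near Ys) => q.
exact: conn_leibniz.
Qed.

Lemma curvature_coordE p u v Z : smooth_field Z p ->
  curvature D (coord_field p u) (coord_field p v) Z p =
  D p u (fun q => D q (coord_field p v q) Z)
  - D p v (fun q => D q (coord_field p u q) Z).
Proof.
move=> Zs; rewrite /curvature lie_bracket_coord_field !coord_field_id.
by rewrite (linear_prop0 (conn_linear Zs)) subr0.
Qed.

(** Antisymmetrizing [second_deriv_leibniz] removes every term that contains a
    derivative of f: those of first order form a symmetric pair, and
    coordinate derivations commute. *)
Lemma curvature_coord_tensorial p u v Y Z : smooth_field Y p -> smooth_field Z p ->
  Y p = Z p ->
  curvature D (coord_field p u) (coord_field p v) Y p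
  = curvature D (coord_field p u) (coord_field p v) Z p.
Proof.
have us := smooth_coord_field p u; have vs := smooth_coord_field p v.
apply: (@tensorial_eq _ _ _ (fun X => curvature D _ _ X p)).
- move=> {}Y {}Z Ys Zs; have YZs := smooth_fieldD Ys Zs.
  rewrite !curvature_coordE // !second_derivD //.
  by rewrite opprD addrACA.
- move=> f {}Y fs Ys; have fYs := smooth_fieldZ fs Ys.
  rewrite !curvature_coordE // !second_deriv_leibniz //;
    try exact: smooth_dirder_coord_field.
  rewrite !coord_field_id (dirder_comm u v fs) scalerBr.
  exact: sub_common.
Qed.

End Connections.

(** * Riemannian metrics and statistical structures *)

Section Metric.
Context {R : realType} {n : nat} {M : manifold R n}.
Local Notation V := 'rV[R]_n.+1.
Implicit Types (p q : M) (X Y Z U : M -> V) (f : M -> R).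
Context (g : M -> V -> V -> R) (hg : riemannian_metric g).

Lemma metric_symmetric p u w : g p u w = g p w u.
Proof. by case: hg. Qed.

Lemma metricr p u : scalar (g p u).
Proof. by case: hg => -[]. Qed.

Lemma metricl p w : scalar (fun u => g p u w).
Proof. by case: hg => -[]. Qed.

(** Non-degeneracy, the way vectors are identified below. *)
Lemma metric_inj p u v : (forall w, g p u w = g p v w) -> u = v.
Proof.
move=> uv; apply/eqP; rewrite -subr_eq0; apply/negPn/negP => uv0.
have [_ _ /(_ p _ uv0)] := hg.
rewrite (scalar_propD (metricl p _)) (scalar_propN (metricl p _)) uv subrr.
by rewrite ltxx.
Qed.

Lemma metric_swap p Y Z :
  (fun q => g q (Y q) (Z q)) = (fun q => g q (Z q) (Y q)).
Proof. by apply/funext => q; exact: metric_symmetric. Qed.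

Section Gram.
Variable p : M.
Let G : 'M[R]_n.+1 := \matrix_(i, j) g p (delta_mx 0 i) (delta_mx 0 j).

Lemma gramE u v : (u *m G *m v^T) 0 0 = g p u v.
Proof.
rewrite (scalar_sum_delta u (metricl p v)) -mulmxA mxE; apply: eq_bigr => i _.
rewrite (scalar_sum_delta v (metricr p _)) mxE; congr (_ * _); apply: eq_bigr => j _.
by rewrite !mxE mulrC.
Qed.

Lemma tr_self_adjoint_sq_ge0 (A : V -> V) : linear A ->
  (forall u w, g p (A u) w = g p u (A w)) -> 0 <= \tr (lin1_mx A *m lin1_mx A).
Proof.
move=> Al Asym; apply: (@tr_self_adjoint_sq _ _ G).
- by apply/matrixP => i j; rewrite !mxE metric_symmetric.
- by move=> u u0; rewrite gramE; case: hg => _ _; exact.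
- apply/matrixP => i j; rewrite [LHS]mx_entry_delta [RHS]mx_entry_delta.
  rewrite mulmxA lin1_mxE // gramE mulmxA -mulmxA -trmx_mul lin1_mxE // gramE.
  exact: Asym.
Qed.
End Gram.

Context (D Ds : forall p : M, V -> (M -> V) -> V).
Hypotheses (dual : dual_connections g D Ds).
Hypotheses (tD : torsion_free D) (tDs : torsion_free Ds).

(** Duality applied to the pairs (Y, Z) and (Z, Y) differentiates the same
    function g(Y, Z). *)
Lemma diff_tensor_sym p X Y Z :
  smooth_field X p -> smooth_field Y p -> smooth_field Z p ->
  g p (Ds p (X p) Y - D p (X p) Y) (Z p) = g p (Ds p (X p) Z - D p (X p) Z) (Y p).
Proof.
move=> Xs Ys Zs; have e1 := dual Xs Ys Zs; have e2 := dual Xs Zs Ys.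
rewrite (metric_swap p) e1 in e2.
rewrite !(scalar_propD (metricl p _)) !(scalar_propN (metricl p _)).
rewrite [g p (Ds _ _ _) (Y p)]metric_symmetric.
rewrite [g p (Ds _ _ _) (Z p)]metric_symmetric; lra.
Qed.

Lemma diff_tensor_comm p X Y : smooth_field X p -> smooth_field Y p ->
  Ds p (X p) Y - D p (X p) Y = Ds p (Y p) X - D p (Y p) X.
Proof.
move=> Xs Ys; have := tD Xs Ys; rewrite -(tDs Xs Ys) => e.
exact: sub_exchange.
Qed.

(** Uniqueness of the torsion-free metric connection.  The difference S of the
    two sides satisfies s(X, Y, Z) = s(Y, X, Z) = - s(X, Z, Y) for s(X, Y, Z)
    = g(S_X Y, Z), and six exchanges give s = - s. *)
Lemma levi_civita_mean (LC : forall p : M, V -> (M -> V) -> V) p u Y :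
  levi_civita g LC -> smooth_field Y p ->
  LC p u Y = 2^-1 *: (D p u Y + Ds p u Y).
Proof.
move=> [hL tL gL] Ys.
pose S X Z := D p (X p) Z + Ds p (X p) Z - 2 *: LC p (X p) Z.
pose s X Z W := g p (S X Z) (W p).
have s1 X Z W : smooth_field X p -> smooth_field Z p -> s X Z W = s Z X W.
  move=> Xs Zs; rewrite /s; congr (g p _ _); rewrite /S.
  by apply: sub_mean; rewrite tL // ?tD // tDs.
have s2 X Z W : smooth_field X p -> smooth_field Z p -> smooth_field W p ->
    s X Z W = - s X W Z.
  move=> Xs Zs Ws; rewrite /s /S.
  have e1 := dual Xs Zs Ws; have e2 := dual Xs Ws Zs; have e3 := gL p X Z W Xs Zs Ws.
  rewrite (metric_swap p) e1 in e2; rewrite e1 in e3.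
  rewrite !(scalar_propD (metricl p _)) !(scalar_propN (metricl p _)).
  rewrite !(scalar_propZ (metricl p _)).
  rewrite [g p (Z p) _]metric_symmetric in e2 e3.
  rewrite ![g p (W p) _]metric_symmetric ![g p (Z p) _]metric_symmetric in e2 e3 *; lra.
have us := smooth_coord_field p u.
have s0 : S (coord_field p u) Y = 0.
  apply: (@metric_inj p) => w; have ws := smooth_coord_field p w.
  rewrite (scalar_prop0 (metricl p _)) -[w](coord_field_id p w) -/(s _ _ _).
  have e1 := s2 _ _ _ us Ys ws; have e2 := s1 _ _ Y us ws.
  have e3 := s2 _ _ _ ws us Ys; have e4 := s1 _ _ (coord_field p u) ws Ys.
  have e5 := s2 _ _ _ Ys ws us; have e6 := s1 _ _ (coord_field p w) Ys us.
  lra.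
move: s0; rewrite /S coord_field_id => /eqP; rewrite subr_eq0 => /eqP ->.
by rewrite scalerA mulVf ?scale1r // pnatr_eq0.
Qed.

End Metric.

(** * The shape operator of the Reeb field *)

Section Smat.
Context {R : realType} {d : nat} {M : manifold R (2 * d)}.
Local Notation V := 'rV[R]_(2 * d).+1.
Implicit Types (p q : M) (X Y Z U : M -> V) (f : M -> R).
Context (Om : M -> V -> V -> R) (al : M -> V -> R) (Th : M -> V -> V) (E : M -> V)
  (g : M -> V -> V -> R) (LC D Ds : forall p : M, V -> (M -> V) -> V).
Hypotheses (hshs : shs Om al) (hE : reeb_field Om al E).
Hypotheses (hacm : compatible_acm Om al Th E g) (hLC : levi_civita g LC).
Hypotheses (hD : smat_shs_connection Om E g D Ds) (hst : statistical D Ds).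

Let hg : riemannian_metric g. Proof. by case: hacm => -[]. Qed.
Let Thl p : linear (Th p). Proof. by case: hacm => -[[]]. Qed.
Let Ths X p : smooth_field X p -> smooth_field (fun q => Th q (X q)) p.
Proof. by case: hacm => -[[_ H] _] _ _ _ _; exact: H. Qed.
Let ThTh p v : Th p (Th p v) = - v + al p v *: E p. Proof. by case: hacm. Qed.
Let ThE p : Th p (E p) = 0. Proof. by case: hacm => _ _ []. Qed.
Let alTh p v : al p (Th p v) = 0. Proof. by case: hacm => _ _ []. Qed.
Let alE p v : al p v = g p v (E p). Proof. by case: hacm. Qed.
Let gE p u v : g p u v = Om p u (Th p v) + al p u * al p v. Proof. by case: hacm. Qed.
Let Es p : smooth_field E p. Proof. by case: hE. Qed.
Let Om_reebl p v : Om p (E p) v = 0. Proof. by case: hE. Qed.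
Let alE1 p : al p (E p) = 1. Proof. by case: hE. Qed.
Let Omb : bilinear_field Om. Proof. by case: hshs => -[[]]. Qed.
Let Om0 p u : Om p u u = 0. Proof. by case: hshs => -[[]]. Qed.
Let als : covector_field al. Proof. by case: hshs. Qed.
Let cD : linear_connection D. Proof. by case: hD => -[]. Qed.
Let cDs : linear_connection Ds. Proof. by case: hD => -[]. Qed.
Let dual : dual_connections g D Ds. Proof. by case: hD. Qed.
Let DE p v : D p v E = 0. Proof. by case: hD. Qed.
Let DOm : parallel_bilinear D Om. Proof. by case: hD. Qed.
Let tD : torsion_free D. Proof. by case: hst. Qed.
Let tDs : torsion_free Ds. Proof. by case: hst. Qed.
Let cLC : linear_connection LC. Proof. by case: hLC. Qed.
Let tLC : torsion_free LC. Proof. by case: hLC. Qed.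
Let mean p u Y : smooth_field Y p -> LC p u Y = 2^-1 *: (D p u Y + Ds p u Y).
Proof. exact: (levi_civita_mean hg dual tD tDs _ hLC). Qed.

Lemma Om_reebr p v : Om p v (E p) = 0.
Proof.
have [Or Ol _] := Omb.
have := Om0 p (v + E p).
rewrite (scalar_propD (Ol p _)) !(scalar_propD (Or p _)) !Om0 !Om_reebl.
by rewrite !(add0r, addr0).
Qed.

(** Compatibility read backwards: Th represents - Om with respect to g. *)
Lemma metric_Th p u v : g p u (Th p v) = - Om p u v.
Proof.
have [Or _ _] := Omb.
rewrite gE alTh mulr0 addr0 ThTh (scalar_propD (Or p _)) (scalar_propN (Or p _)).
by rewrite (scalar_propZ (Or p _)) Om_reebr mulr0 addr0.
Qed.

(** Since g(Y, Th Z) = - Om(Y, Z), duality computes Ds (Th Z) and parallelism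
    of Om computes D Z from the same derivative. *)
Lemma Ds_Th p u Z : smooth_field Z p ->
  Ds p u (fun q => Th q (Z q)) = Th p (D p u Z).
Proof.
move=> Zs; apply: (metric_inj hg (p := p)) => w.
have us := smooth_coord_field p u; have ws := smooth_coord_field p w.
have := dual us ws (Ths Zs); rewrite !coord_field_id.
have -> : (fun q => g q (coord_field p w q) (Th q (Z q))) =
    fun q => - Om q (coord_field p w q) (Z q).
  by apply/funext => q; exact: metric_Th.
have [_ _ Os] := Omb; rewrite dirderN; last exact: Os.
have := DOm us ws Zs; rewrite !coord_field_id => e.
rewrite metric_Th ![g p _ w](metric_symmetric hg) metric_Th; lra.
Qed.

(** The field E has unit length and D E = 0. *)
Lemma Ds_E_orth p u : g p (Ds p u E) (E p) = 0.
Proof.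
have us := smooth_coord_field p u.
have := dual us (Es p) (Es p); rewrite !coord_field_id DE.
have -> : (fun q => g q (E q) (E q)) = fun=> 1.
  by apply/funext => q; rewrite -alE alE1.
rewrite dirder_cst (scalar_prop0 (metricl hg p _)) add0r => /esym.
by rewrite (metric_symmetric hg).
Qed.

Lemma Ds_E_diff p X : smooth_field X p ->
  Ds p (X p) E = Ds p (E p) X - D p (E p) X.
Proof. by move=> Xs; rewrite -(diff_tensor_comm tD tDs Xs (Es p)) DE subr0. Qed.

(** The total symmetry of g(K_X Y, Z), evaluated with E in one slot. *)
Lemma Ds_E_self_adjoint p u w : g p (Ds p u E) w = g p u (Ds p w E).
Proof.
have us := smooth_coord_field p u; have ws := smooth_coord_field p w.
have e1 := diff_tensor_sym hg dual us (Es p) ws.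
have e2 := diff_tensor_comm tD tDs us ws.
have e3 := diff_tensor_sym hg dual ws us (Es p).
rewrite !coord_field_id !DE !subr0 in e1 e2 e3.
by rewrite e1 e2 e3 (metric_symmetric hg).
Qed.

Lemma Ds_EE p : Ds p (E p) E = 0.
Proof.
apply: (metric_inj hg (p := p)) => w.
rewrite (scalar_prop0 (metricl hg p _)) Ds_E_self_adjoint.
by rewrite (metric_symmetric hg) Ds_E_orth.
Qed.

(** Since E is a unit geodesic field, this is the shape operator of the leaves
    orthogonal to E. *)
Definition shape p (u : V) : V := LC p u E.
Local Notation A := shape.

Lemma shapeE p u : A p u = 2^-1 *: Ds p u E.
Proof. by rewrite /shape mean // DE add0r. Qed.

Lemma shape_linear p : linear (A p).
Proof. exact: (conn_linear cLC (Es p)). Qed.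

Lemma shape_smooth p X : smooth_field X p -> smooth_field (fun q => A q (X q)) p.
Proof. by move=> Xs; exact: (conn_smooth cLC Xs (Es p)). Qed.

Lemma shape_self_adjoint p u w : g p (A p u) w = g p u (A p w).
Proof.
rewrite !shapeE (scalar_propZ (metricl hg p _)) (scalar_propZ (metricr hg p _)).
by rewrite Ds_E_self_adjoint.
Qed.

Lemma shape_E p : A p (E p) = 0.
Proof. by rewrite shapeE Ds_EE scaler0. Qed.

(** Apply [Ds_Th] to Th Z and then Th to both sides.  The multiples of E that
    come from Th^2 vanish: one is killed by Th, and the other is the
    E-component of D_E (Th Z), which is zero because Th Z is orthogonal to E
    and Ds_E E = 0. *)
Lemma D_E_Th p Z : smooth_field Z p ->
  D p (E p) (fun q => Th q (Z q)) = Th p (Ds p (E p) Z).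
Proof.
move=> Zs; have ThZs := Ths Zs.
set W := D p (E p) _.
have alW : al p W = 0.
  rewrite alE; have := dual (Es p) ThZs (Es p).
  rewrite Ds_EE (scalar_prop0 (metricr hg p _)) addr0 => <-.
  have -> : (fun q => g q (Th q (Z q)) (E q)) = fun=> 0.
    by apply/funext => q; rewrite -alE alTh.
  exact: dirder_cst.
have alZs : smooth_fun (fun q => al q (Z q)) p by have [_] := als; exact.
have NZs : smooth_field (fun q => -1 *: Z q) p.
  by apply: smooth_fieldZ => //; exact: smooth_fun_cst.
have ThThZ : (fun q => Th q (Th q (Z q))) = fun q => -1 *: Z q + al q (Z q) *: E q.
  by apply/funext => q; rewrite ThTh scaleN1r.
(* In what follows the derivative of al Z contributes a multiple of E. *)
have := Ds_Th (E p) ThZs; rewrite ThThZ (connD cDs) //; last exact: smooth_fieldZ.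
rewrite (conn_const cDs) // (conn_leibniz cDs) // Ds_EE scaler0 addr0 scaleN1r.
move=> /(congr1 (Th p)); rewrite (linear_propD (Thl p)) (linear_propN (Thl p)).
rewrite (linear_propZ (Thl p)) ThE scaler0 addr0 ThTh -/W alW scale0r addr0.
by move/oppr_inj.
Qed.

(** Averaging [Ds_Th] and [D_E_Th]. *)
Lemma LC_E_Th p Z : smooth_field Z p ->
  LC p (E p) (fun q => Th q (Z q)) = Th p (LC p (E p) Z).
Proof.
move=> Zs; rewrite !mean //; last exact: Ths.
by rewrite D_E_Th // Ds_Th // (linear_propZ (Thl p)) (linear_propD (Thl p)) addrC.
Qed.

(** Twice A u is the difference Ds_E U - D_E U for any U extending u, and Th
    exchanges the two terms. *)
Lemma shape_Th p u : A p (Th p u) = - Th p (A p u).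
Proof.
have us := smooth_coord_field p u.
have := Ds_E_diff (Ths us); rewrite coord_field_id => e.
have := Ds_E_diff us; rewrite coord_field_id => e'.
rewrite !shapeE e e' D_E_Th // Ds_Th // (linear_propZ (Thl p)).
by rewrite (linear_propD (Thl p)) (linear_propN (Thl p)) -scalerN opprB.
Qed.

(** (LC_w A) U, the covariant derivative of the shape operator. *)
Definition dshape p (w : V) (U : M -> V) : V :=
  LC p w (fun q => A q (U q)) - A p (LC p w U).

Lemma dshapeD p w X Y : smooth_field X p -> smooth_field Y p ->
  dshape p w (fun q => X q + Y q) = dshape p w X + dshape p w Y.
Proof.
move=> Xs Ys; rewrite /dshape.
have -> : (fun q => A q (X q + Y q)) = fun q => A q (X q) + A q (Y q).
  by apply/funext => q; exact: (linear_propD (shape_linear q)).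
rewrite (connD cLC w (shape_smooth Xs) (shape_smooth Ys)).
by rewrite (connD cLC w Xs Ys) (linear_propD (shape_linear p)) opprD addrACA.
Qed.

Lemma dshapeZ p w f X : smooth_fun f p -> smooth_field X p ->
  dshape p w (fun q => f q *: X q) = f p *: dshape p w X.
Proof.
move=> fs Xs; rewrite /dshape; have Al := shape_linear p.
have -> : (fun q => A q (f q *: X q)) = fun q => f q *: A q (X q).
  by apply/funext => q; exact: (linear_propZ (shape_linear q)).
rewrite (conn_leibniz cLC w fs (shape_smooth Xs)).
rewrite (conn_leibniz cLC w fs Xs) (linear_propD Al) !(linear_propZ Al).
by rewrite opprD addrACA subrr add0r scalerBr.
Qed.

Lemma dshape_eq p w X Y : smooth_field X p -> smooth_field Y p -> X p = Y p ->
  dshape p w X = dshape p w Y.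
Proof.
apply: (@tensorial_eq _ _ _ (dshape p w)); first exact: dshapeD.
by move=> f X'; exact: dshapeZ.
Qed.

Lemma dshape_E p w : dshape p w E = - A p (A p w).
Proof.
rewrite /dshape.
have -> : (fun q => A q (E q)) = fun=> 0 by apply/funext => q; exact: shape_E.
by rewrite (conn_zero_field cLC) sub0r.
Qed.

Local Notation dA p w := (fun u => dshape p w (coord_field p u)).

Lemma dshape_linear p w : linear (dA p w).
Proof.
move=> a u v.
have us := smooth_coord_field p u; have vs := smooth_coord_field p v.
have as' := smooth_fun_cst a p.
rewrite -(dshapeZ w as' us) -dshapeD //; last exact: smooth_fieldZ.
by congr (dshape p w); apply/funext => q; rewrite /coord_field /coord_change linearP.
Qed.

(** LC_E commutes with Th, so it preserves the anticommutation of A with Th.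
    *)
Lemma dshape_Th p u : dA p (E p) (Th p u) = - Th p (dA p (E p) u).
Proof.
have us := smooth_coord_field p u; have Al := shape_linear p.
rewrite (@dshape_eq _ _ _ (fun q => Th q (coord_field p u q))) ?coord_field_id //;
  [|exact: smooth_coord_field|exact: Ths].
rewrite /dshape.
have -> : (fun q => A q (Th q (coord_field p u q))) =
    fun q => -1 *: Th q (A q (coord_field p u q)).
  by apply/funext => q; rewrite scaleN1r; exact: shape_Th.
have As := shape_smooth us.
rewrite (conn_const cLC _ _ (Ths As)) scaleN1r (LC_E_Th As) (LC_E_Th us).
rewrite (shape_Th p) (linear_propD (Thl p)) (linear_propN (Thl p)).
by rewrite opprD.
Qed.

Lemma tr_dshape p : \tr (lin1_mx (dA p (E p))) = 0.
Proof.
apply: (tr_anticommute (dshape_linear p (E p)) (Thl p) (ThTh p) (dshape_Th p)).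
rewrite (@dshape_eq _ _ _ E) ?coord_field_id //; last exact: smooth_coord_field.
by rewrite dshape_E shape_E (linear_prop0 (shape_linear p)) oppr0.
Qed.

(** The bracket of coordinate fields vanishes, so torsion-freeness turns R(u,
    E) E into (LC_u A) E - (LC_E A) u, whose second part is traceless. *)
Lemma ricci_shape p : ricci LC p (E p) (E p) = - \tr (lin1_mx (A p) *m lin1_mx (A p)).
Proof.
have es := smooth_coord_field p (E p).
have curv u :
    curvature LC (coord_field p u) (coord_field p (E p)) (coord_field p (E p)) p
    = - A p (A p u) - dA p (E p) u.
  have us := smooth_coord_field p u.
  rewrite (curvature_coord_tensorial cLC u (E p) es (Es p)) ?coord_field_id //.
  rewrite (curvature_coordE cLC) //.
  have <- : dshape p u (coord_field p (E p)) = - A p (A p u).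
    by rewrite (@dshape_eq _ _ _ E) ?coord_field_id ?dshape_E.
  have Al := shape_linear p.
  have := tLC us es; rewrite lie_bracket_coord_field !coord_field_id => /subr0_eq e.
  by rewrite /dshape e opprB addrA subrK.
(* The trace of LC_E A is zero; put it on the right to compare term by term. *)
rewrite /ricci -[RHS](subrK (\tr (lin1_mx (dA p (E p))))) {2}tr_dshape addr0 !tr_lin1.
have -> : lin1_mx (A p) *m lin1_mx (A p) = lin1_mx (fun u => A p (A p u)).
  have Al := shape_linear p.
  have AAl : linear (fun u => A p (A p u)).
    by move=> a u v; rewrite (Al a u v); exact: Al.
  by apply: eq_mul_rV => u; rewrite mulmxA !lin1_mxE.
rewrite tr_lin1 -!sumrN -big_split /=; apply: eq_bigr => i _.
by rewrite curv !mxE.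
Qed.

Lemma ricci_E_le0 p : ricci LC p (E p) (E p) <= 0.
Proof.
rewrite ricci_shape oppr_le0.
exact: (tr_self_adjoint_sq_ge0 hg (shape_linear p) (shape_self_adjoint p)).
Qed.

Lemma reeb_neq0 p : E p != 0.
Proof.
apply/eqP => E0; have := alE1 p; rewrite alE E0 (scalar_prop0 (metricr hg p _)).
by move/eqP; rewrite eq_sym oner_eq0.
Qed.
End Smat.

(** * Positive Ricci curvature *)

Theorem proposition4p12 (R : realType) (d : nat) (M : manifold R (2 * d))
    (Om : M -> 'rV[R]_(2 * d).+1 -> 'rV[R]_(2 * d).+1 -> R)
    (al : M -> 'rV[R]_(2 * d).+1 -> R)
    (Th : M -> 'rV[R]_(2 * d).+1 -> 'rV[R]_(2 * d).+1)
    (E : M -> 'rV[R]_(2 * d).+1)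
    (g : M -> 'rV[R]_(2 * d).+1 -> 'rV[R]_(2 * d).+1 -> R)
    (LC : forall p : M, 'rV[R]_(2 * d).+1 -> (M -> 'rV[R]_(2 * d).+1) ->
          'rV[R]_(2 * d).+1) :
  shs Om al -> reeb_field Om al E -> compatible_acm Om al Th E g ->
  levi_civita g LC -> positive_definite (ricci LC) ->
  forall D Ds : forall p : M, 'rV[R]_(2 * d).+1 ->
      (M -> 'rV[R]_(2 * d).+1) -> 'rV[R]_(2 * d).+1,
    smat_shs_connection Om E g D Ds -> ~ statistical D Ds.
Proof.
move=> hshs hE hacm hLC Ric D Ds hD hst.
have [p _] := carrier_nonempty M.
have := Ric p (E p) (reeb_neq0 hE hacm p).
by rewrite ltNge (ricci_E_le0 hshs hE hacm hLC hD hst p).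
Qed.
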